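(* Let $K$ be a finite simplicial complex, $\mathcal{V}$ a multivector field on $K$, and $N,N'\subseteq K$ closed. Let $S$ be an invariant set isolated by $N$, by $N'$, and by $N\cup N'$ under $\mathcal{V}$. If $(P,E)$ is a strong index pair for $S$ in $N$ and $(P',E')$ is a strong index pair for $S$ in $N'$ under $\mathcal{V}$, then the pair $$\big(\mathrm{pf}_{N\cup N'}(P\cup P'),\ \mathrm{pf}_{N\cup N'}(E\cup E')\big)$$ is a strong index pair for $S$ in $N\cup N'$ under $\mathcal{V}$.
   Context: $K$ is identified with its finite set of simplices; $\sigma\le\sigma'$ means that $\sigma$ is a (not necessarily proper) face of $\sigma'$. For $A\subseteq K$, $\mathrm{cl}(A)=\{\tau\in K : \tau\le\sigma \text{ for some }\sigma\in A\}$, $\mathrm{cl}(\sigma)=\mathrm{cl}(\{\sigma\})$, $A$ is closed if $\mathrm{cl}(A)=A$, and $\mathrm{mo}(A)=\mathrm{cl}(A)\setminus A$. A multivector is a set $A\subseteq K$ such that $\sigma\le\tau\le\sigma'$ with $\sigma,\sigma'\in A$, $\tau\in K$ implies $\tau\in A$. A multivector field $\mathcal{V}$ on $K$ is a partition of $K$ into multivectors; $[\sigma]_{\mathcal{V}}$ is the element of $\mathcal{V}$ containing $\sigma$. A multivector $V$ is critical if the relative simplicial homology $H_p(\mathrm{cl}(V),\mathrm{mo}(V))\neq 0$ for some $p$, and regular otherwise. $F_{\mathcal{V}}(\sigma)=\mathrm{cl}(\sigma)\cup[\sigma]_{\mathcal{V}}$ and $F_{\mathcal{V}}(A)=\bigcup_{\sigma\in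 A}F_{\mathcal{V}}(\sigma)$. A path (under $\mathcal{V}$) from $\rho(a)$ to $\rho(b)$ is a map $\rho:\mathbb{Z}\cap[a,b]\to K$ with $\rho(i)\in F_{\mathcal{V}}(\rho(i-1))$ for all integers $a<i\le b$. A solution is a map $\rho:\mathbb{Z}\to K$ with $\rho(i)\in F_{\mathcal{V}}(\rho(i-1))$ for all $i$. It is essential if for each $i$ with $[\rho(i)]_{\mathcal{V}}$ regular there are $i^-<i<i^+$ with $[\rho(i^-)]_{\mathcal{V}}\ne[\rho(i)]_{\mathcal{V}}\ne[\rho(i^+)]_{\mathcal{V}}$. $\mathrm{Inv}(A)$ is the set of $\sigma\in A$ for which there is an essential solution $\rho$ with $\rho(\mathbb{Z})\subseteq A$ and $\rho(0)=\sigma$. $A$ is invariant if $\mathrm{Inv}(A)=A$. An invariant set $S\subseteq N$, $N$ closed, is isolated by $N$ if every path with values in $N$ and both endpoints in $S$ has all its values in $S$. Index pair in $N$: for $S$ an invariant set isolated by $N$, a pair of closed sets $E\subseteq P\subseteq N$ is an index pair for $S$ in $N$ if (1) $F_{\mathcal{V}}(P)\cap N\subseteq P$; (2) $F_{\mathcal{V}}(E)\cap N\subseteq E$; (3) $F_{\mathcal{V}}(P\setminus E)\subseteq N$; (4) $S=\mathrm{Inv}(P\setminus E)$. It is a strong index pair for $S$ in $N$ if in addition for each $\tau\in E$ there are $\sigma\in S$ and a path with values in $P$ from $\sigma$ to $\tau$. Push forward: for a closed set $M\subseteq K$ and $A\subseteq M$, $\mathrm{pf}_M(A)$ is the set of all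 simplices of $A$ together with all $\sigma\in M$ for which there is a path with values in $M$ from an element of $A$ to $\sigma$. *)

(* Defs.v *)
From HB Require Import structures.
From mathcomp Require Import all_boot all_order all_algebra.
From mathcomp Require Import boolp.

Set Implicit Arguments.
Unset Strict Implicit.
Unset Printing Implicit Defensive.

Import Order.TTheory GRing.Theory Num.Theory.
Local Open Scope ring_scope.

(* A finite simplicial complex with vertices in the finite type T is the set of
   its (nonempty) simplices, each simplex being the set of its vertices; the
   face relation is \subset. *)
Definition simplicial_complex (T : finType) (K : {set {set T}}) : Prop :=
  set0 \notin K /\
  forall sigma tau : {set T},
    sigma \in K -> tau \subset sigma -> tau != set0 -> tau \in K.

Section Closure.
Variables (T : finType) (K : {set {set T}}).

Definition cl (A : {set {set T}}) : {set {set T}} :=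
  [set tau in K | [exists sigma in A, tau \subset sigma]].

Definition mo (A : {set {set T}}) : {set {set T}} := cl A :\: A.

(* Since cl A \subset K, this entails A \subset K. *)
Definition is_closed (A : {set {set T}}) : Prop := cl A = A.

End Closure.

Section RelativeHomology.
Variables (R : comNzRingType) (T : finType).

Local Notation chain := {ffun {set T} -> R}.

(* The chains supported on the simplices of L with n vertices, i.e., of
   dimension n - 1. *)
Definition chains_on (L : {set {set T}}) (n : nat) : {pred chain} :=
  fun c => [forall sigma, (c sigma != 0) ==> (sigma \in L) && (#|sigma| == n)].

(* The boundary for the orientation given by the enumeration of T: the faces
   sigma :\ v of a simplex sigma have sign (-1)^i, where i is the position of v
   in sigma. Below, sigma = v |: tau. The boundary of a vertex is 0: the empty
   face is discarded, so the homology is not reduced. *)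
Definition boundary (c : chain) : chain :=
  [ffun tau : {set T} => if tau == set0 then 0 else
     \sum_(v | v \notin tau)
       (-1) ^+ #|[set w in tau | (enum_rank w < enum_rank v)%N]| * c (v |: tau)].

Lemma boundaryB : {morph boundary : c d / c - d}.
Proof.
move=> c d; apply/ffunP=> tau; rewrite !ffunE.
case: eqP => _; first by rewrite subr0.
by rewrite -sumrB; apply: eq_bigr => v _; rewrite !ffunE mulrBr.
Qed.

Lemma boundary0 : boundary 0 = 0.
Proof. by rewrite -[X in boundary X](subrr 0) boundaryB subrr. Qed.

Lemma chains_on_zmod_closed L n : zmod_closed (chains_on L n).
Proof.
split=> [|c d /forallP hc /forallP hd].
  by apply/forallP=> s; rewrite ffunE eqxx.
apply/forallP=> s; apply/implyP; rewrite !ffunE.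
have [c0|/(implyP (hc s))//] := eqVneq (c s) 0.
have [d0|/(implyP (hd s))//] := eqVneq (d s) 0.
by rewrite c0 d0 subr0 eqxx.
Qed.

HB.instance Definition _ L n :=
  GRing.isZmodClosed.Build chain (chains_on L n) (chains_on_zmod_closed L n).

Variables (L L0 : {set {set T}}) (p : nat).

Definition rel_cycle : {pred chain} :=
  fun c => (c \in chains_on L p.+1) && (boundary c \in chains_on L0 p).

Lemma rel_cycle_zmod_closed : zmod_closed rel_cycle.
Proof.
split=> [|c d /andP[hc hc'] /andP[hd hd']]; apply/andP; split.
- exact: rpred0.
- by rewrite boundary0 rpred0.
- exact: rpredB.
- by rewrite boundaryB rpredB.
Qed.

HB.instance Definition _ :=
  GRing.isZmodClosed.Build chain rel_cycle rel_cycle_zmod_closed.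

Definition rel_cycle_type := {c : chain | c \in rel_cycle}.
HB.instance Definition _ := SubChoice.on rel_cycle_type.
HB.instance Definition _ := [SubChoice_isSubZmodule of rel_cycle_type by <:].

Definition rel_boundary : {pred rel_cycle_type} :=
  fun c => `[< exists2 d : chain, d \in chains_on L p.+2 &
                 val c - boundary d \in chains_on L0 p.+1 >].

Lemma rel_boundary_zmod_closed : zmod_closed rel_boundary.
Proof.
split=> [|c c' /asboolP[d hd hcd] /asboolP[d' hd' hcd']]; apply/asboolP.
  exists 0; first exact: rpred0.
  by rewrite boundary0 subrr rpred0.
exists (d - d'); first exact: rpredB.
by rewrite raddfB boundaryB opprD addrACA -opprD rpredB.
Qed.

HB.instance Definition _ :=
  GRing.isZmodClosed.Build rel_cycle_type rel_boundary rel_boundary_zmod_closed.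

(* H_p(L, L0; R) *)
Definition rel_homology : zmodType := Quotient.quot rel_boundary.

End RelativeHomology.

Definition multivector (T : finType) (K A : {set {set T}}) : Prop :=
  A \subset K /\
  forall sigma tau sigma' : {set T},
    sigma \in A -> sigma' \in A -> tau \in K ->
    sigma \subset tau -> tau \subset sigma' -> tau \in A.

Definition multivector_field (T : finType) (K : {set {set T}})
    (VV : {set {set {set T}}}) : Prop :=
  partition VV K /\ forall A, A \in VV -> multivector K A.

(* R is the ring of coefficients. *)
Definition critical (R : comNzRingType) (T : finType) (K A : {set {set T}}) : Prop :=
  exists p : nat, exists x : rel_homology R (cl K A) (mo K A) p, x != 0.

Definition regular (R : comNzRingType) (T : finType) (K A : {set {set T}}) : Prop :=
  ~ critical R K A.

Section Dynamics.
Variables (R : comNzRingType) (T : finType).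
Variables (K : {set {set T}}) (VV : {set {set {set T}}}).

(* pblock VV sigma is the multivector of VV containing sigma. *)
Definition F (sigma : {set T}) : {set {set T}} := cl K [set sigma] :|: pblock VV sigma.

Definition Fset (A : {set {set T}}) : {set {set T}} := \bigcup_(sigma in A) F sigma.

(* rho restricted to the integer interval [a, b] is a path with values in A; the
   values of rho outside [a, b] are irrelevant. *)
Definition path_in (A : {set {set T}}) (rho : int -> {set T}) (a b : int) : Prop :=
  [/\ a <= b,
      forall i : int, a <= i <= b -> rho i \in K,
      forall i : int, a < i <= b -> rho i \in F (rho (i - 1)) &
      forall i : int, a <= i <= b -> rho i \in A].

Definition path_in_from_to (A : {set {set T}}) (sigma tau : {set T}) : Prop :=
  exists (rho : int -> {set T}) (a b : int),
    [/\ path_in A rho a b, rho a = sigma & rho b = tau].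

Definition solution (rho : int -> {set T}) : Prop :=
  forall i : int, rho i \in K /\ rho i \in F (rho (i - 1)).

Definition essential (rho : int -> {set T}) : Prop :=
  forall i : int, regular R K (pblock VV (rho i)) ->
    exists im ip : int,
      [/\ im < i, i < ip,
          pblock VV (rho im) <> pblock VV (rho i) &
          pblock VV (rho i) <> pblock VV (rho ip)].

Definition Inv (A : {set {set T}}) : {set {set T}} :=
  [set sigma in A | `[< exists rho : int -> {set T},
     [/\ solution rho, essential rho, forall i, rho i \in A & rho 0 = sigma] >]].

Definition invariant_set (A : {set {set T}}) : Prop := Inv A = A.

(* To be used for S invariant and N closed. *)
Definition isolated_by (S N : {set {set T}}) : Prop :=
  S \subset N /\
  forall (rho : int -> {set T}) (a b : int),
    path_in N rho a b -> rho a \in S -> rho b \in S ->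
    forall i : int, a <= i <= b -> rho i \in S.

(* To be used for S invariant and isolated by N. *)
Definition index_pair (S N P E : {set {set T}}) : Prop :=
  [/\ is_closed K P, is_closed K E, E \subset P & P \subset N] /\
  [/\ Fset P :&: N \subset P,
      Fset E :&: N \subset E,
      Fset (P :\: E) \subset N &
      S = Inv (P :\: E)].

Definition strong_index_pair (S N P E : {set {set T}}) : Prop :=
  index_pair S N P E /\
  forall tau, tau \in E -> exists2 sigma, sigma \in S & path_in_from_to P sigma tau.

Definition pf (M A : {set {set T}}) : {set {set T}} :=
  A :|: [set sigma in M |
          `[< exists2 alpha, alpha \in A & path_in_from_to M alpha sigma >]].

End Dynamics.

(* Main.v *)
Require Import Defs.
From mathcomp Require Import all_boot all_order all_algebra.
From mathcomp Require Import boolp zify.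

(** A path in [N :|: N'] starting in [P] stays in [P :\: E] until it possibly
    enters [E], because [F] maps [P :\: E] into [N] and [P] is forward invariant
    in [N]; likewise for [P'] and [E'].  Hence the difference of the two push
    forwards lies in [(P :\: E) :|: (P' :\: E')], and a solution in it cannot
    leave either of these two parts in forward time: it lies entirely in one of
    them, so its values are in [S].  Conversely [S] avoids the push forward of
    [E :|: E'], since a path from [S] to [E :|: E'] followed by a path back to
    [S] would contradict isolation by [N :|: N']. *)

Set Implicit Arguments.
Unset Strict Implicit.
Unset Printing Implicit Defensive.

Import Order.TTheory GRing.Theory Num.Theory.
Local Open Scope ring_scope.

(** * Closed sets, and paths under the multivector field *)

Section PushForward.
Variables (T : finType) (K : {set {set T}}) (VV : {set {set {set T}}}).
Implicit Types (A B M : {set {set T}}) (x y z : {set T}) (rho : int -> {set T}).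

Local Notation F := (F K VV).
Local Notation path_in := (path_in K VV).
Local Notation path_in_from_to := (path_in_from_to K VV).
Local Notation pf := (pf K VV).

Lemma is_closedP A :
  is_closed K A <->
  A \subset K /\ forall x y, x \in A -> y \in K -> y \subset x -> y \in A.
Proof.
split=> [clA|[/subsetP sAK down]].
  split=> [|x y Ax Ky syx]; first by rewrite -clA; apply/subsetP=> x /setIdP[].
  by rewrite -clA inE Ky; apply/existsP; exists x; rewrite Ax.
apply/setP=> y; rewrite inE; apply/andP/idP.
  by case=> Ky /existsP[x /andP[Ax syx]]; apply: down syx.
by move=> Ay; split; [exact: sAK | apply/existsP; exists y; rewrite Ay /=].
Qed.

Lemma is_closedU A B : is_closed K A -> is_closed K B -> is_closed K (A :|: B).
Proof.
move=> /is_closedP[sAK downA] /is_closedP[sBK downB]; apply/is_closedP.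
split=> [|x y /setUP[Ax|Bx] Ky syx]; first by rewrite subUset sAK.
- by rewrite inE (downA x).
- by rewrite inE (downB x) ?orbT.
Qed.

Lemma face_in_F x y : y \in K -> y \subset x -> y \in F x.
Proof.
by move=> Ky syx; rewrite !inE Ky; apply/orP; left; apply/existsP; exists x;
  rewrite !inE eqxx.
Qed.

Lemma path_in_ind (Q : {set T} -> Prop) A rho (a b : int) :
  path_in A rho a b -> Q (rho a) ->
  (forall x y, Q x -> y \in F x -> y \in A -> Q y) ->
  forall i : int, a <= i <= b -> Q (rho i).
Proof.
move=> [_ _ step inA] Qa QF i ib.
(* Writing [i] as [a] plus a natural number turns the claim into an induction on that number. *)
have -> : i = a + `|i - a|%N%:Z by lia.
have : a + `|i - a|%N%:Z <= b by lia.
elim: `|i - a|%N => [|n IHn] nb; first by rewrite addr0.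
apply: QF (IHn _) _ _; first by lia.
  by have -> : a + n%:Z = a + n.+1%:Z - 1; [lia | apply: step; lia].
by apply: inA; lia.
Qed.

Lemma path_in_refl A x : x \in K -> x \in A -> path_in_from_to A x x.
Proof.
by move=> Kx Ax; exists (fun=> x), 0, 0; split=> //; split=> // i; lia.
Qed.

Lemma path_in_sub A B rho (a b : int) :
  (forall i : int, a <= i <= b -> rho i \in B) ->
  path_in A rho a b -> path_in B rho a b.
Proof. by move=> inB [? ? ? _]; split. Qed.

(** The junction time [m] is kept because isolation gets applied to the value at [m]; transitivity
    alone would lose that value. *)
Lemma path_in_cat A x y z :
  path_in_from_to A x y -> path_in_from_to A y z ->
  exists rho (a m b : int),
    [/\ path_in A rho a b, a <= m <= b, rho a = x, rho m = y & rho b = z].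
Proof.
move=> [r [a [b [[ab rK rF rA] rax rby]]]] [s [c [d [[cd sK sF sA] scy sdz]]]].
pose rho (i : int) := if i <= b then r i else s (i - b + c).
have rhor (i : int) : i <= b -> rho i = r i by rewrite /rho => ->.
(* Both branches agree at [i = b], since [r b = y = s c]; hence the step from [b] to [b + 1] is a
   step of [s]. *)
have rhos (i : int) : b <= i -> rho i = s (i - b + c).
  rewrite /rho => bi; case: ifP => // ib.
  have -> : i = b by lia.
  by rewrite subrr add0r rby scy.
exists rho, a, b, (b + (d - c)); split; [|lia|by rewrite rhor| by rewrite rhor|].
  split=> [|i ib|i ib|i ib]; first lia.
  - case: (lerP i b) => h; first by rewrite rhor //; apply: rK; lia.
    by rewrite rhos; [apply: sK; lia | lia].
  - case: (lerP i b) => h; first by rewrite !rhor; [apply: rF; lia | lia..].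
    rewrite !rhos; [|lia..].
    by have -> : i - 1 - b + c = i - b + c - 1; [lia | apply: sF; lia].
  - case: (lerP i b) => h; first by rewrite rhor //; apply: rA; lia.
    by rewrite rhos; [apply: sA; lia | lia].
by rewrite rhos; [rewrite -sdz; congr s; lia | lia].
Qed.

Lemma path_in_trans A x y z :
  path_in_from_to A x y -> path_in_from_to A y z -> path_in_from_to A x z.
Proof.
move=> xy yz; have [rho [a [m [b [rhoA _ rhoa _ rhob]]]]] := path_in_cat xy yz.
by exists rho, a, b.
Qed.

Lemma path_in_step A x y :
  x \in K -> y \in K -> x \in A -> y \in A -> y \in F x -> path_in_from_to A x y.
Proof.
move=> Kx Ky Ax Ay xy; exists (fun i : int => if i <= 0 then x else y), 0, 1.
split=> //; split=> // i ib; try by case: ifP.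
by have -> : i = 1 by lia.
Qed.

Lemma path_in_from_to_sub A B x y :
  A \subset B -> path_in_from_to A x y -> path_in_from_to B x y.
Proof.
move=> /subsetP sAB [rho [a [b [rhoA rhoa rhob]]]]; exists rho, a, b; split=> //.
apply: path_in_sub (rhoA) => i ib; apply: sAB.
by case: rhoA => _ _ _; apply.
Qed.

(** * Push forwards as least forward invariant sets *)

Lemma pf_sub M A : A \subset M -> pf M A \subset M.
Proof. by move=> sAM; rewrite subUset sAM; apply/subsetP=> x /setIdP[]. Qed.

Lemma sub_pf M A : A \subset pf M A.
Proof. exact: subsetUl. Qed.

(** Constant paths account for the simplices of [A] itself, so both members of the union defining
    [pf] are covered by paths. *)
Lemma pfP M A x :
  M \subset K -> A \subset M ->
  (x \in pf M A) <-> exists2 y, y \in A & path_in_from_to M y x.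
Proof.
move=> /subsetP sMK /subsetP sAM; split=> [/setUP[Ax|]|[y Ay yx]].
- by exists x => //; apply: path_in_refl; [apply: sMK|]; apply: sAM.
- by case/setIdP=> _ /asboolP.
- apply/setUP; right; rewrite inE; apply/andP; split; last by apply/asboolP; exists y.
  by case: yx => rho [a [b [[ab _ _ rhoM] _ <-]]]; apply: rhoM; lia.
Qed.

Lemma pf_forward M A x y :
  M \subset K -> A \subset M ->
  x \in pf M A -> y \in F x -> y \in M -> y \in pf M A.
Proof.
move=> sMK sAM pfx xy My; have Mx := subsetP (pf_sub sAM) _ pfx.
have [z Az zx] := (pfP x sMK sAM).1 pfx.
apply/(pfP y sMK sAM); exists z => //; apply: path_in_trans zx _.
by apply: path_in_step => //; apply: (subsetP sMK).
Qed.

(** A path in [M] starting in [A] can never leave [B]. This bounds a push forward from above by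
    checking single steps only. *)
Lemma pf_min M A B :
  M \subset K -> A \subset M -> A \subset B ->
  (forall x y, x \in B -> y \in F x -> y \in M -> y \in B) -> pf M A \subset B.
Proof.
move=> sMK sAM sAB BF; apply/subsetP=> x /(pfP x sMK sAM)[y Ay].
case=> rho [a [b [rhoM rhoa <-]]]; have ab : a <= b by case: rhoM.
apply: (path_in_ind (Q := fun z => z \in B) rhoM _ BF); last by lia.
by rewrite rhoa (subsetP sAB).
Qed.

Lemma pf_subset M A B :
  M \subset K -> B \subset M -> A \subset B -> pf M A \subset pf M B.
Proof.
move=> sMK sBM sAB; apply: pf_min (subset_trans sAB sBM) _ _ => //.
  exact: subset_trans sAB (sub_pf _ _).
by move=> x y; apply: pf_forward.
Qed.

(** Faces of [x] lie in [F x], so forward invariance in the closed set [M] already gives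
    closedness. *)
Lemma pf_closed M A : is_closed K M -> A \subset M -> is_closed K (pf M A).
Proof.
move=> /is_closedP[sMK downM] sAM; apply/is_closedP.
split=> [|x y pfx Ky syx]; first exact: subset_trans (pf_sub sAM) sMK.
apply: pf_forward (pfx) _ _ => //; first exact: face_in_F.
exact: downM (subsetP (pf_sub sAM) _ pfx) Ky syx.
Qed.

Lemma path_in_pf M A x y :
  M \subset K -> A \subset M ->
  x \in pf M A -> path_in_from_to M x y -> path_in_from_to (pf M A) x y.
Proof.
move=> sMK sAM pfx [rho [a [b [rhoM rhoa rhob]]]]; exists rho, a, b; split=> //.
apply: path_in_sub (rhoM); apply: (path_in_ind (Q := fun z => z \in pf M A) rhoM).
  by rewrite rhoa.
by move=> z t; apply: pf_forward.
Qed.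

Lemma solution_path_in A rho (a b : int) :
  solution K VV rho -> (forall i, rho i \in A) -> a <= b -> path_in A rho a b.
Proof. by move=> sol inA ab; split=> // i _; case: (sol i). Qed.

End PushForward.

(** * Invariant parts, index pairs and isolation *)

Section Invariance.
Variables (R : comNzRingType) (T : finType).
Variables (K : {set {set T}}) (VV : {set {set {set T}}}).
Implicit Types (A B C M N P E S : {set {set T}}).

Local Notation F := (F K VV).
Local Notation Inv := (Inv R K VV).
Local Notation index_pair := (index_pair R K VV).

Lemma Inv_sub A : Inv A \subset A.
Proof. by apply/subsetP=> x /setIdP[]. Qed.

Lemma InvS A B : A \subset B -> Inv A \subset Inv B.
Proof.
move=> /subsetP sAB; apply/subsetP=> x /setIdP[/sAB Bx /asboolP[rho [? ? inA ?]]].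
rewrite inE Bx; apply/asboolP; exists rho; split=> // i; exact: sAB.
Qed.

(* If infinitely many past values lie in [A], so does the whole solution;
   otherwise all sufficiently old values lie in [B]. *)
Lemma Inv_subU A B C :
  C \subset A :|: B ->
  (forall x y, x \in A -> y \in F x -> y \in C -> y \in A) ->
  (forall x y, x \in B -> y \in F x -> y \in C -> y \in B) ->
  Inv C \subset Inv A :|: Inv B.
Proof.
move=> /subsetP sC AF BF; apply/subsetP=> x /setIdP[_ /asboolP].
case=> [rho [sol ess inC rho0]].
have fwd (D : {set {set T}}) (i j : int) :
    (forall x y, x \in D -> y \in F x -> y \in C -> y \in D) ->
    rho i \in D -> i <= j -> rho j \in D.
  move=> DF Di ij; have ijp := solution_path_in sol inC ij.
  by apply: (path_in_ind (Q := fun z => z \in D) ijp Di DF); lia.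
have inInv (D : {set {set T}}) : (forall i, rho i \in D) -> x \in Inv D.
  by move=> inD; rewrite inE -{1}rho0 inD; apply/asboolP; exists rho.
case: (pselect (forall i : int, exists2 j : int, j <= i & rho j \in A)) => [oldA|].
  apply/setUP; left; apply: inInv => i; have [j ji Aj] := oldA i.
  exact: fwd AF Aj ji.
move=> /existsNP[i notA]; apply/setUP; right; apply: inInv => k.
(* No value at a time up to [i] is in [A], so the value at [Num.min i k] is in [B]; forward
   invariance carries this on to time [k]. *)
apply: (fwd _ (Num.min i k) _ BF); last by lia.
have /setUP[Am|//] := sC _ (inC (Num.min i k)).
by case: notA; exists (Num.min i k) => //; lia.
Qed.

(** [P] is forward invariant only relative to [N], but condition (3) keeps [F x] inside [N] when [x]
    is outside [E]. *)
Lemma index_pair_step S N P E x y :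
  index_pair S N P E -> x \in P :\: E -> y \in F x -> y \in P.
Proof.
case=> _ [/subsetP PF _ /subsetP PEF _] PEx xy; apply: PF; apply/setIP.
split; last by apply: PEF; apply/bigcupP; exists x.
by apply/bigcupP; exists x => //; case/setDP: PEx.
Qed.

(** If [S] met the push forward, some path in [M] would run from [S] through a point of [A] back to
    [S]; isolation would put that point in [S]. *)
Lemma disjoint_pf S M A :
  M \subset K -> isolated_by K VV S M -> A \subset M -> [disjoint S & A] ->
  (forall x, x \in A -> exists2 s, s \in S & path_in_from_to K VV M s x) ->
  [disjoint S & pf K VV M A].
Proof.
move=> sMK [_ iso] sAM SA fromS; apply/pred0P=> x /=; apply/negP=> /andP[Sx].
move=> /(pfP VV x sMK sAM)[y Ay yx]; have [s Ss sy] := fromS y Ay.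
have [rho [a [m [b [rhoM amb rhoa rhom rhob]]]]] := path_in_cat sy yx.
suff Sy : y \in S by have /pred0P/(_ y)/= := SA; rewrite Sy Ay.
by rewrite -rhom; apply: iso rhoM _ _ _ amb; rewrite ?rhoa ?rhob.
Qed.

End Invariance.

Theorem theorem20 (R : comNzRingType) (T : finType)
    (K : {set {set T}}) (VV : {set {set {set T}}})
    (N N' S P E P' E' : {set {set T}}) :
  simplicial_complex K ->
  multivector_field K VV ->
  is_closed K N ->
  is_closed K N' ->
  invariant_set R K VV S ->
  isolated_by K VV S N ->
  isolated_by K VV S N' ->
  isolated_by K VV S (N :|: N') ->
  strong_index_pair R K VV S N P E ->
  strong_index_pair R K VV S N' P' E' ->
  strong_index_pair R K VV S (N :|: N')
    (pf K VV (N :|: N') (P :|: P')) (pf K VV (N :|: N') (E :|: E')).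
Proof.
move=> _ _ clN clN' invS _ _ isoM [ipP sP] [ipP' sP'].
set M := N :|: N'; set Q := pf _ _ _ (P :|: P'); set D := pf _ _ _ (E :|: E').
have clM : is_closed K M by exact: is_closedU.
have [sMK _] := (is_closedP K M).1 clM.
have [[_ _ sEP sPN] [_ _ PEF SPE]] := ipP.
have [[_ _ sEP' sPN'] [_ _ PEF' SPE']] := ipP'.
have sPM : P :|: P' \subset M by rewrite setUSS.
have sEPU : E :|: E' \subset P :|: P' by rewrite setUSS.
have sEM := subset_trans sEPU sPM.
have sQM : Q \subset M := pf_sub _ _ sPM.
have sPQ : P :|: P' \subset Q := sub_pf _ _ _ _.
have /subUsetP[/subsetP sED /subsetP sED'] : E :|: E' \subset D := sub_pf _ _ _ _.
have QF x y : x \in Q -> y \in F K VV x -> y \in M -> y \in Q by exact: pf_forward.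
have DF x y : x \in D -> y \in F K VV x -> y \in M -> y \in D by exact: pf_forward.
have PF x y : x \in P :\: E -> y \in F K VV x -> y \notin D -> y \in P :\: E.
  move=> PEx xy nDy; apply/setDP; split; first exact: index_pair_step ipP PEx xy.
  by apply: contra nDy; apply: sED.
have PF' x y : x \in P' :\: E' -> y \in F K VV x -> y \notin D -> y \in P' :\: E'.
  move=> PEx xy nDy; apply/setDP; split; first exact: index_pair_step ipP' PEx xy.
  by apply: contra nDy; apply: sED'.
have sQD : Q :\: D \subset (P :\: E) :|: (P' :\: E').
  (* By minimality of [Q], it suffices that [D :|: ((P :\: E) :|: (P' :\: E'))] contains [P :|: P']
     and is forward invariant in [M]. *)
  rewrite subDset; apply: pf_min => // [|x y].
    apply/subsetP=> x Px; apply/setUP; have [|nDx] := boolP (x \in D); [by left | right].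
    case/setUP: Px => Px; apply/setUP; [left | right]; apply/setDP; split=> //.
      by apply: contra nDx; apply: sED.
    by apply: contra nDx; apply: sED'.
  move=> DPx xy My; apply/setUP; have [|nDy] := boolP (y \in D); [by left | right].
  case/setUP: DPx => [Dx|/setUP[PEx|PEx]]; first by rewrite (DF x) in nDy.
  - by rewrite inE (PF x).
  - by rewrite inE (PF' x) ?orbT.
have SD : [disjoint S & D].
  (* [S] avoids [E] and [E'] as the invariant part of each difference; strongness of the two pairs
     supplies the paths from [S]. *)
  apply: disjoint_pf isoM _ _ _ => // [|x].
    apply/pred0P=> x; apply/negP=> /=/andP[Sx /setUP[]].
      by move: Sx; rewrite SPE => /(subsetP (Inv_sub _ _ _ _))/setDP[_ /negP].
    by move: Sx; rewrite SPE' => /(subsetP (Inv_sub _ _ _ _))/setDP[_ /negP].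
  case/setUP=> [/sP|/sP'] [s Ss sx]; exists s => //.
    by apply: path_in_from_to_sub sx; apply: subset_trans sPM; apply: subsetUl.
  by apply: path_in_from_to_sub sx; apply: subset_trans sPM; apply: subsetUr.
have sSQD : S \subset Q :\: D.
  rewrite subsetD SD andbT; apply: subset_trans sPQ; rewrite {1}SPE.
  apply: subset_trans (Inv_sub _ _ _ _) _.
  exact: subset_trans (subsetDl _ _) (subsetUl _ _).
split; first split.
- by split=> //; [exact: pf_closed | exact: pf_closed | exact: pf_subset].
- split.
  + by apply/subsetP=> y /setIP[/bigcupP[x Qx xy] My]; apply: QF xy My.
  + by apply/subsetP=> y /setIP[/bigcupP[x Dx xy] My]; apply: DF xy My.
  + apply/bigcupsP=> x /(subsetP sQD)/setUP[PEx|PEx].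
      apply: subset_trans (subsetUl _ _); apply: subset_trans PEF.
      exact: (bigcup_sup x).
    apply: subset_trans (subsetUr _ _); apply: subset_trans PEF'.
    exact: (bigcup_sup x).
  + apply/eqP; rewrite eqEsubset -{1}invS InvS //=.
    (* [S] is doubled to [S :|: S], so that one copy becomes [Inv (P :\: E)] and the other
       [Inv (P' :\: E')]. *)
    rewrite -[S in X in _ \subset X]setUid {1}SPE SPE'.
    by apply: Inv_subU sQD _ _ => x y PEx xy /setDP[_ nDy]; [apply: PF xy _ | apply: PF' xy _].
- move=> x /(pfP VV x sMK sEM)[e EEe ex].
  (* The path from [S] to [e] lies in [P] or [P'], hence in [Q]; the path from [e] to [x] is only
     known to lie in [M], but starting in [Q] it stays there. *)
  have Qe : e \in Q by apply: (subsetP (subset_trans sEPU sPQ)).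
  have [s Ss se] : exists2 s, s \in S & path_in_from_to K VV Q s e.
    case/setUP: EEe => [/sP|/sP'] [s Ss sx]; exists s => //.
      by apply: path_in_from_to_sub sx; apply: subset_trans sPQ; apply: subsetUl.
    by apply: path_in_from_to_sub sx; apply: subset_trans sPQ; apply: subsetUr.
  by exists s => //; apply: path_in_trans se _; apply: path_in_pf.
Qed.
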